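(* Let $q$ be a prime power, let $l_n$ ($n\ge0$) be a non-decreasing sequence of non-negative integers, and let $f\in\mathbb{L}$ be irrational (i.e. $f\notin\mathbb{F}_q(X)$) with principal convergents $P_k/Q_k$, and put $n_k:=\deg(Q_k)$. Then, for almost all $g\in\mathbb{L}$ (with respect to Haar measure), \[ |\{Qf\}-g|<\frac{1}{q^{l_n}},\quad \deg(Q)=n,\qquad\text{for infinitely many } Q\in\mathbb{F}_q[X] \] if and only if \[ \sum_{k=0}^{\infty}\left(\sum_{n=n_k}^{n_{k+1}-1}q^{\,n-\max\{n_{k+1},l_n\}}\right)=\infty. \]
   Context: $\mathbb{F}_q$ is the finite field with $q$ elements, $\mathbb{F}_q[X]$ the polynomial ring and $\mathbb{F}_q(X)$ its fraction field. $\mathbb{F}_q((X^{-1}))$ is the field of formal Laurent series $a_nX^n+a_{n-1}X^{n-1}+\cdots$ ($a_i\in\mathbb{F}_q$, $n\in\mathbb{Z}$), with norm $|h|=q^{\deg h}$ ($|0|=0$), where $\deg$ is the exponent of the leading nonzero term. For $h=\sum_{i\le n}a_iX^i$, the fractional part is $\{h\}=\sum_{i\le -1}a_iX^i$. $\mathbb{L}=\{h: |h|<1\}$, a compact group carrying a unique translation-invariant Haar probability measure. $P_k/Q_k$ are the principal convergents of the continued fraction expansion of $f$ (with polynomial partial quotients). *)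

(* Defs.v *)
From HB Require Import structures.
From mathcomp Require Import all_boot all_order all_algebra.
From mathcomp Require Import zify.
From mathcomp Require Import all_classical all_reals all_analysis.

Set Implicit Arguments.
Unset Strict Implicit.
Unset Printing Implicit Defensive.

Import Order.TTheory GRing.Theory Num.Theory.
Local Open Scope classical_set_scope.
Local Open Scope ring_scope.

(* [f i] is the coefficient of X^i; only finitely many exponents i >= 0 occur,
   while there may be infinitely many negative ones. *)
Record laurent (F : fieldType) := Laurent {
  lcoef :> int -> F;
  lcoef_bounded : exists d : int, forall i : int, d < i -> lcoef i = 0 }.

HB.instance Definition _ (F : fieldType) := gen_eqMixin (laurent F).
HB.instance Definition _ (F : fieldType) := gen_choiceMixin (laurent F).

Section LaurentRing.
Variable F : fieldType.
Implicit Types (f g h : laurent F) (d n : int).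

Definition lbound d (f : int -> F) := forall i : int, d < i -> f i = 0.

Lemma laurentP f g : f =1 g -> f = g.
Proof.
case: f g => [f fb] [g gb] /= /funext E; rewrite E in fb *.
by congr Laurent; exact: Prop_irrelevance.
Qed.

Lemma lboundW d e (f : int -> F) : d <= e -> lbound d f -> lbound e f.
Proof. by move=> de fb i ei; apply: fb; apply: le_lt_trans ei. Qed.

Fact lzero_bounded : exists d, lbound d (fun=> 0).
Proof. by exists 0. Qed.
Definition lzero := Laurent lzero_bounded.

Fact lopp_bounded f : exists d, lbound d (fun i => - f i).
Proof. by case: (lcoef_bounded f) => d fb; exists d => i /fb ->; rewrite oppr0. Qed.
Definition lopp f := Laurent (lopp_bounded f).

Fact ladd_bounded f g : exists d, lbound d (fun i => f i + g i).
Proof.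
case: (lcoef_bounded f) (lcoef_bounded g) => [d fb] [e gb].
by exists (Num.max d e) => i; rewrite gt_max => /andP[/fb -> /gb ->]; rewrite addr0.
Qed.
Definition ladd f g := Laurent (ladd_bounded f g).

Fact laddA : associative ladd.
Proof. by move=> f g h; apply: laurentP => i /=; rewrite addrA. Qed.
Fact laddC : commutative ladd.
Proof. by move=> f g; apply: laurentP => i /=; rewrite addrC. Qed.
Fact ladd0 : left_id lzero ladd.
Proof. by move=> f; apply: laurentP => i /=; rewrite add0r. Qed.
Fact laddN : left_inverse lzero lopp ladd.
Proof. by move=> f; apply: laurentP => i /=; rewrite addNr. Qed.

HB.instance Definition _ := GRing.isZmodule.Build (laurent F) laddA laddC ladd0 laddN.

Definition lconv (f g : int -> F) n : F := \sum_(i \in [set: int]) f i * g (n - i).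

(* The first [N] coefficients, from X^d downwards, of a series in X^-1. *)
Let tr d N (f : int -> F) : {poly F} := \poly_(k < N) f (d - k%:Z).

Lemma int_below (m n : int) : n <= m -> exists k : nat, n = m - k%:Z.
Proof. by move=> nm; exists (absz (m - n)); lia. Qed.

Lemma lconv_bound d e (f g : int -> F) :
  lbound d f -> lbound e g -> lbound (d + e) (lconv f g).
Proof.
move=> fb gb n den; apply: fsbig1 => i _.
have [/fb ->|id] := ltP d i; first by rewrite mul0r.
by rewrite gb ?mulr0 //; lia.
Qed.

Lemma lconv_tr d e N k (f g : int -> F) : lbound d f -> lbound e g -> (k < N)%N ->
  lconv f g (d + e - k%:Z) = (tr d N f * tr e N g)`_k.
Proof.
move=> fb gb kN; rewrite coefM /lconv.
rewrite (@fsbigE _ _ _ _ _ [seq d - (val i)%:Z | i <- enum 'I_k.+1]) //; first last.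
- move=> i _ /mapP iNr.
  have [/fb ->|id] := ltP d i; first by rewrite mul0r.
  rewrite gb ?mulr0 // ltNge; apply/negP => ile; apply: iNr.
  have ik : (`|d - i|%N < k.+1)%N by lia.
  by exists (Ordinal ik); rewrite ?mem_enum //=; lia.
- rewrite map_inj_uniq ?enum_uniq // => i j /= /(can_inj (subKr d)) [ij].
  exact: val_inj.
rewrite big_map big_enum_cond /=; apply: eq_big => [i|i _]; first by rewrite in_setT.
have ik := ltn_ord i; rewrite !coef_poly !ifT; try lia.
by congr (_ * g _); lia.
Qed.

Fact lmul_bounded f g : exists d, lbound d (lconv f g).
Proof.
case: (lcoef_bounded f) (lcoef_bounded g) => [d fb] [e gb].
by exists (d + e); apply: lconv_bound.
Qed.
Definition lmul f g := Laurent (lmul_bounded f g).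

Lemma lmulC : commutative lmul.
Proof.
move=> f g; apply: laurentP => n /=.
case: (lcoef_bounded f) (lcoef_bounded g) => [d fb] [e gb].
have [den|ned] := ltP (d + e) n.
  rewrite (lconv_bound fb gb) // (lconv_bound gb fb) //; lia.
have [k ->] := int_below ned.
rewrite (lconv_tr fb gb (ltnSn _)) mulrC [d + e as X in X - _]addrC.
by rewrite (lconv_tr gb fb (ltnSn _)).
Qed.

Lemma coefM_agree (p p' r : {poly F}) k :
  (forall i, (i <= k)%N -> p`_i = p'`_i) -> (p * r)`_k = (p' * r)`_k.
Proof. by move=> pp; rewrite !coefM; apply: eq_bigr => i _; rewrite pp -1?ltnS. Qed.

Lemma lmul3 d e c f g h k : lbound d f -> lbound e g -> lbound c h ->
  lmul (lmul f g) h (d + e + c - k%:Z)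
  = (tr d k.+1 f * tr e k.+1 g * tr c k.+1 h)`_k.
Proof.
move=> fb gb hb /=; rewrite (lconv_tr (lconv_bound fb gb) hb (ltnSn k)).
apply: coefM_agree => i ik; rewrite coef_poly ltnS ik.
exact: lconv_tr.
Qed.

Lemma lmulA : associative lmul.
Proof.
move=> f g h; rewrite [LHS]lmulC (lmulC g h); apply: laurentP => n.
case: (lcoef_bounded f) (lcoef_bounded g) (lcoef_bounded h) => [d fb] [e gb] [c hb].
have [den|ned] := ltP (d + e + c) n.
  rewrite /= (lconv_bound (lconv_bound hb gb) fb) ?(lconv_bound (lconv_bound fb gb) hb) //.
  lia.
have [k ->] := int_below ned.
rewrite (lmul3 _ fb gb hb) (_ : d + e + c = c + e + d); last lia.
rewrite (lmul3 _ hb gb fb).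
by rewrite -[tr d _ _ * _ * _]mulrA [in RHS]mulrC [tr c _ _ * _]mulrC.
Qed.

Definition lmono_coef (a : F) n (i : int) : F := if i == n then a else 0.
Fact lmono_bounded a n : exists d, lbound d (lmono_coef a n).
Proof. by exists n => i ni; rewrite /lmono_coef gt_eqF. Qed.
Definition lmono a n := Laurent (lmono_bounded a n).

Lemma lmul_mono a n f i : lmul (lmono a n) f i = a * f (i - n).
Proof.
rewrite /= /lconv (@fsbigE _ _ _ _ _ [:: n]) //.
  by rewrite big_cons big_nil in_setT /= addr0 /lmono_coef eqxx.
by move=> j _; rewrite inE /lmono_coef => /negPf ->; rewrite mul0r.
Qed.

Definition lone := lmono 1 0.

Lemma lmul1 : left_id lone lmul.
Proof. by move=> f; apply: laurentP => i; rewrite lmul_mono subr0 mul1r. Qed.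

Lemma lmulDl : left_distributive lmul ladd.
Proof.
move=> f g h; apply: laurentP => n.
case: (lcoef_bounded f) (lcoef_bounded g) (lcoef_bounded h) => [d' fb'] [e gb'] [c hb].
pose d := Num.max d' e.
have fb : lbound d f by apply: lboundW fb'; rewrite le_max lexx.
have gb : lbound d g by apply: lboundW gb'; rewrite le_max lexx orbT.
have fgb : lbound d (ladd f g) by move=> i di /=; rewrite fb // gb // addr0.
rewrite /=; have [den|ned] := ltP (d + c) n.
  by rewrite (lconv_bound fgb hb) // (lconv_bound fb hb) // (lconv_bound gb hb) // addr0.
have [k ->] := int_below ned.
rewrite (lconv_tr fgb hb (ltnSn _)) (lconv_tr fb hb (ltnSn _)) (lconv_tr gb hb (ltnSn _)).
rewrite -coefD -mulrDl; apply: coefM_agree => i ik.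
by rewrite coefD !coef_poly ltnS ik.
Qed.

Lemma lone_neq0 : lone != 0.
Proof.
apply/eqP => /(congr1 (fun f : laurent F => f 0)) /=.
by rewrite /lmono_coef eqxx => /eqP; rewrite oner_eq0.
Qed.

HB.instance Definition _ :=
  GRing.Zmodule_isComNzRing.Build (laurent F) lmulA lmulC lmul1 lmulDl lone_neq0.

Lemma laurent_deg f : f != 0 -> exists n, f n != 0 /\ lbound n f.
Proof.
move=> f0; case: (lcoef_bounded f) => d fb.
have [k fk] : exists k, f (d - k%:Z) != 0.
  apply: contrapT => /forallNP N; case/eqP: f0; apply: laurentP => i /=.
  have [/fb //|id] := ltP d i.
  have := N `|d - i|%N; have -> : d - `|d - i|%N%:Z = i by lia.
  by move=> /negP/negPn/eqP.
have ex : exists k, f (d - k%:Z) != 0 by exists k.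
case: (ex_minnP ex) => m fm mmin; exists (d - m%:Z); split=> // i im.
have [/fb //|id] := ltP d i.
apply/eqP; apply: contraT => fi.
have : (m <= `|d - i|)%N by apply: mmin; have -> : d - `|d - i|%N%:Z = i by lia.
lia.
Qed.

Lemma lmul_agree (f g g' : laurent F) n :
  lbound 0 f -> (forall i, n <= i -> g i = g' i) -> (f * g) n = (f * g') n.
Proof.
move=> fb gg; apply: eq_fsbigr => i _.
have [/fb ->|i0] := ltP 0 i; first by rewrite !mul0r.
by rewrite gg //; lia.
Qed.

Lemma lexp_bound (u : laurent F) k : lbound (-1) u -> lbound (- k%:Z) (u ^+ k).
Proof.
move=> ub; elim: k => [|k IH].
  by move=> i i0 /=; rewrite /lmono_coef gt_eqF //; lia.
rewrite exprS => i ik; apply: (lconv_bound ub IH); lia.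
Qed.

Lemma lcoef_sum (I : Type) (r : seq I) (G : I -> laurent F) n :
  (\sum_(i <- r) G i) n = \sum_(i <- r) G i n.
Proof. by elim/big_rec2: _ => // i a b _ <-. Qed.

Lemma lgeom (u : laurent F) : lbound (-1) u -> exists g : laurent F, (1 - u) * g = 1.
Proof.
move=> ub; pose c n := \sum_(k < `|n|.+1) (u ^+ k) n.
have cb : lbound 0 c.
  move=> i i0; apply: big1 => k _; apply: (lexp_bound ub); lia.
have cE n (m : nat) : - m%:Z <= n -> c n = (\sum_(k < m.+1) u ^+ k) n.
  move=> mn; have [n0|n0] := ltP 0 n.
    rewrite cb // lcoef_sum big1 // => k _; apply: (lexp_bound ub); lia.
  have le : (`|n| <= m)%N by lia.
  rewrite lcoef_sum /c.
  rewrite (big_ord_widen_cond m.+1 xpredT (fun k => (u ^+ k) n)) ?ltnS //.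
  rewrite big_mkcond /=; apply: eq_bigr => k _.
  case: ltnP => // nk; apply/esym/(lexp_bound ub); lia.
have cb' : exists d, lbound d c by exists 0.
exists (Laurent cb'); apply: laurentP => n.
have u1b : lbound 0 (1 - u).
  move=> i i0; rewrite /= ub; last lia.
  by rewrite /lmono_coef gt_eqF // subr0.
have [n0|n0] := ltP 0 n.
  have /(_ n) := lconv_bound u1b cb; rewrite addr0 => /(_ n0) E; apply: (etrans E).
  by rewrite /= /lmono_coef gt_eqF.
rewrite (@lmul_agree _ _ (\sum_(k < `|n|.+1) u ^+ k)) //; last first.
  move=> i ni; apply: cE; lia.
have := subrXX 1 u `|n|.+1.
under eq_bigr do rewrite expr1n mul1r.
move=> <-; rewrite expr1n.
have un : (u ^+ `|n|.+1) n = 0 by apply: (lexp_bound ub); lia.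
by rewrite [LHS]/= un subr0.
Qed.

Lemma laurent_unit f : f != 0 -> exists g, f * g = 1.
Proof.
move=> /laurent_deg[d [fd fb]].
pose m := lmono (f d)^-1 (- d).
have ub : lbound (-1) (1 - m * f).
  move=> i i1.
  have -> : (1 - m * f) i = lmono_coef 1 0 i - (m * f) i by [].
  rewrite lmul_mono opprK /lmono_coef; case: eqP => [->|/eqP i0].
    by rewrite add0r mulVf // subrr.
  rewrite (fb (i + d)) ?mulr0 ?subr0 //; lia.
have [g] := lgeom ub; rewrite opprB addrC subrK => mfg.
by exists (m * g); rewrite mulrA [f * m]mulrC.
Qed.

Definition linv f : laurent F := xget 0 [set g | f * g = 1].

Lemma lmulV f : f != 0 -> linv f * f = 1.
Proof.
move=> /laurent_unit[g fg]; rewrite mulrC /linv.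
by case: xgetP => [h _ //|/(_ g)].
Qed.

Lemma linv0 : linv 0 = 0.
Proof.
rewrite /linv; case: xgetP => // g _ /=; rewrite mul0r => /esym/eqP.
by rewrite oner_eq0.
Qed.

HB.instance Definition _ := GRing.ComNzRing_isField.Build (laurent F) lmulV linv0.

End LaurentRing.

Section LaurentParts.
Variable F : fieldType.
Implicit Types h : laurent F.

Definition lpoly_coef (p : {poly F}) (i : int) : F :=
  if i is Posz n then p`_n else 0.
Fact lpoly_bounded p : exists d, lbound d (lpoly_coef p).
Proof.
exists (size p)%:Z => -[n|n] //= sn; rewrite nth_default //; lia.
Qed.
Definition lpoly p := Laurent (lpoly_bounded p).

Definition lirrational h :=
  ~ exists P Q : {poly F}, Q != 0 /\ h = lpoly P / lpoly Q.

(* By convention [ldeg 0 = 0]. *)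
Definition ldeg h : int :=
  xget 0 [set n | h n != 0 /\ forall i : int, n < i -> h i = 0].

Definition lfrac_coef h (i : int) : F := if i <= -1 then h i else 0.
Fact lfrac_bounded h : exists d, lbound d (lfrac_coef h).
Proof. by exists (-1) => i; rewrite /lfrac_coef leNgt => ->. Qed.
Definition lfrac h := Laurent (lfrac_bounded h).

(* The bound on the exponents exceeds the degree whenever the latter is
   nonnegative, so no coefficient is lost: see [lpart_decomp]. *)
Definition lpolypart h : {poly F} := \poly_(n < `|ldeg h|.+1) h n%:Z.

Lemma ldegP h : h != 0 -> h (ldeg h) != 0 /\ lbound (ldeg h) h.
Proof.
move=> /laurent_deg[n hn]; rewrite /ldeg.
by case: xgetP => [m _ //|/(_ n)].
Qed.

Lemma lpart_decomp h : h = lpoly (lpolypart h) + lfrac h.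
Proof.
apply: laurentP => -[n|n] /=.
  rewrite /lfrac_coef /= addr0 coef_poly; case: ltnP => // nh.
  have [->//|h0] := eqVneq h 0.
  by have [_ ->] := ldegP h0; last lia.
by rewrite add0r.
Qed.

(* The complete quotients f_0 = f and f_(k+1) = 1 / {f_k}. *)
Fixpoint complete_quotient h (k : nat) : laurent F :=
  if k is k'.+1 then (lfrac (complete_quotient h k'))^-1 else h.

Definition partial_quotient h (k : nat) : {poly F} :=
  lpolypart (complete_quotient h k).

(* [convergent_num h k] / [convergent_den h k] is the k-th convergent P_k / Q_k. *)
Fixpoint convergent_num h (k : nat) : {poly F} :=
  match k with
  | 0 => partial_quotient h 0
  | k1.+1 => if k1 is k2.+1
             then partial_quotient h k * convergent_num h k1 + convergent_num h k2
             else partial_quotient h 1 * partial_quotient h 0 + 1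
  end.

Fixpoint convergent_den h (k : nat) : {poly F} :=
  match k with
  | 0 => 1
  | k1.+1 => if k1 is k2.+1
             then partial_quotient h k * convergent_den h k1 + convergent_den h k2
             else partial_quotient h 1
  end.

Definition convergent_deg h (k : nat) : nat := (size (convergent_den h k)).-1.

End LaurentParts.

Section UnitBall.
Variable F : finFieldType.

Definition lnorm (h : laurent F) : rat :=
  if h == 0 then 0 else #|F|%:R ^ ldeg h.

Definition in_lball : {pred laurent F} := fun h => lnorm h < 1.

Lemma in_lballP (h : laurent F) : reflect (lbound (-1) h) (h \in in_lball).
Proof.
rewrite unfold_in /in_lball /lnorm.
have q1 : (1 : rat) < #|F|%:R by rewrite ltr1n card_finNzRing_gt1.
have [->|h0] := eqVneq h 0; first by rewrite ltr01; apply: ReflectT.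
have [hd hb] := ldegP h0.
rewrite -[X in _ < X](expr0z (#|F|%:R : rat)) ltr_eXz2l //.
apply: (iffP idP) => [d0|b]; first by apply: lboundW hb; lia.
by rewrite ltNge; apply/negP => d0; case/eqP: hd; apply: b; lia.
Qed.

Fact in_lball_zmod_closed : zmod_closed in_lball.
Proof.
split; first exact/in_lballP.
move=> f g /in_lballP fb /in_lballP gb; apply/in_lballP => i i1 /=.
by rewrite fb // gb // subrr.
Qed.
HB.instance Definition _ :=
  GRing.isZmodClosed.Build (laurent F) in_lball in_lball_zmod_closed.

Record lball := LBall { lball_val :> laurent F; _ : lball_val \in in_lball }.

HB.instance Definition _ := [isSub for lball_val].
HB.instance Definition _ := [Choice of lball by <:].
HB.instance Definition _ := [SubChoice_isSubZmodule of lball by <:].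
HB.instance Definition _ := isPointed.Build lball 0.

Definition lball_open : set (set lball) :=
  [set U | forall g : lball, U g ->
     exists2 e : rat, 0 < e & forall h : lball, lnorm (h - g : lball) < e -> U h].

(* [lball] with its Borel sigma-algebra. *)
Definition lball_borel := g_sigma_algebraType lball_open.

End UnitBall.

(* A probability measure on the Borel sets of the compact group [lball F] is the
   Haar measure iff it is translation-invariant. *)
Definition is_haar (R : realType) (F : finFieldType)
    (mu : probability (lball_borel F) R) : Prop :=
  forall (h : lball F) (A : set (lball_borel F)), measurable A ->
    mu [set (h + g : lball F) | g in (A : set (lball F))] = mu A.

(* Main.v *)
From HB Require Import structures.
Require Import Defs.
From mathcomp Require Import all_boot all_order all_algebra.
From mathcomp Require Import all_classical all_reals all_analysis.
From mathcomp Require Import zify ring lra.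

Set Implicit Arguments.
Unset Strict Implicit.
Unset Printing Implicit Defensive.

Import Order.TTheory GRing.Theory Num.Theory.
Local Open Scope classical_set_scope.
Local Open Scope ring_scope.

(* Let n_k = deg Q_k.  Best approximation says that {Qf} has norm at least
   q^-n_k for nonzero Q of degree < n_k; hence the first n_k digits of {Qf}, for
   deg Q < n_k, run exactly once through all words of length n_k.

   Divergence: shrink the radius for deg Q = n, n_k <= n < n_(k+1), to q^-m_n
   with m_n = max(n_(k+1), l_n).  The balls of a given degree are then disjoint,
   and the number of hits of g with degree in a finite range has mean e and
   second moment at most e^2 + 3e, so by Chebyshev's inequality it vanishes with
   probability at most 3/e, which tends to 0.

   Convergence: write Q = A Q_k + Q' with deg Q' < n_k.  If the first l_n digits
   do not see A, then g lies in one of the q^n_k balls of radius q^-l_(n_k)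
   around the {Q'f}, whose total measure is at most q times the summand of index
   n_k - 1, because l is nondecreasing.  Otherwise counting the prefixes of
   length l_n bounds the measure by q times the summand of index n.
   Borel-Cantelli concludes. *)

(** * Degrees of Laurent series *)

Section LaurentDegree.
Variable F : fieldType.
Implicit Types (f g h : laurent F) (p : {poly F}) (d e : int).

(** Degree as a relation: it fails for h = 0, whereas [ldeg] takes a default value there. *)
Definition has_ldeg h d := h d != 0 /\ Defs.lbound d h.

Lemma has_ldeg_neq0 h d : has_ldeg h d -> h != 0.
Proof. by case=> hd _; apply: contraNneq hd => ->. Qed.

Lemma has_ldeg_ex h : h != 0 -> exists d, has_ldeg h d.
Proof. by move=> /laurent_deg[d]; exists d. Qed.

Lemma has_ldeg_uniq h d e : has_ldeg h d -> has_ldeg h e -> d = e.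
Proof.
move=> [hd hbd] [he hbe]; apply/eqP; rewrite eq_le !leNgt.
by apply/andP; split; apply/negP => lt; [case/eqP: hd; apply: hbe | case/eqP: he; apply: hbd].
Qed.

Lemma has_ldegM f g d e :
  has_ldeg f d -> has_ldeg g e -> has_ldeg (f * g) (d + e).
Proof.
move=> [fd fb] [ge gb]; split; last exact: lconv_bound.
have := lconv_tr fb gb (ltn0Sn 0); rewrite !subr0 => E.
by rewrite /= E coefM big_ord_recl big_ord0 addr0 !coef_poly /= !subr0 mulf_neq0.
Qed.

Lemma has_ldegN h d : has_ldeg h d -> has_ldeg (- h) d.
Proof.
move=> [hd hb]; split=> [|i di] /=; first by rewrite oppr_eq0.
by rewrite hb // oppr0.
Qed.

Lemma lpoly_is_additive : zmod_morphism (@lpoly F).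
Proof. by move=> p r; apply: laurentP => -[n|n] /=; rewrite ?coefB ?subr0. Qed.
HB.instance Definition _ :=
  GRing.isZmodMorphism.Build {poly F} (laurent F) (@lpoly F) lpoly_is_additive.

Lemma lpolyC (a : F) : lpoly a%:P = lmono a 0.
Proof.
by apply: laurentP => -[[|n]|n] //=; rewrite coefC /lmono_coef.
Qed.

Lemma lpoly_CM (a : F) p : lpoly (a%:P * p) = lpoly a%:P * lpoly p.
Proof.
apply: laurentP => i; rewrite lpolyC [RHS]lmul_mono subr0.
by case: i => [n|n] /=; rewrite ?coefCM ?mulr0.
Qed.

Lemma lpoly_XM p : lpoly ('X * p) = lpoly 'X * lpoly p.
Proof.
have -> : lpoly 'X = lmono 1 1 :> laurent F.
  by apply: laurentP => -[n|n] //=; rewrite coefX /lmono_coef; case: n => [|[]].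
apply: laurentP => i; rewrite [RHS]lmul_mono mul1r.
case: i => [[|n]|n] /=; rewrite ?coefXM ?mul1r //=.
by rewrite subn1.
Qed.

(** Horner induction on the first factor reduces products to multiplication by X and by constants,
    both of which are products with a monomial series. *)
Lemma lpoly_is_monoid_morphism : monoid_morphism (@lpoly F).
Proof.
split; first exact: lpolyC.
move=> p r; elim/poly_ind: p r => [|p c IH] r; first by rewrite mul0r raddf0 mul0r.
by rewrite mulrDl raddfD /= -mulrA IH lpoly_XM raddfD /= IH lpoly_CM mulrA -mulrDl.
Qed.
HB.instance Definition _ :=
  GRing.isMonoidMorphism.Build {poly F} (laurent F) (@lpoly F)
    lpoly_is_monoid_morphism.

Lemma lpoly_bound p i : (size p)%:Z <= i -> lpoly p i = 0.
Proof. by case: i => [n|n] //= pn; rewrite nth_default //; lia. Qed.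

Lemma has_ldeg_lpoly p : p != 0 -> has_ldeg (lpoly p) (size p).-1%:Z.
Proof.
move=> p0; have p_gt0 : (0 < size p)%N by rewrite size_poly_gt0.
split=> [|i pi]; first by rewrite /= -lead_coefE lead_coef_eq0.
by apply: lpoly_bound; lia.
Qed.

Lemma lpoly_neq0 p : p != 0 -> lpoly p != 0.
Proof. by move=> /has_ldeg_lpoly /has_ldeg_neq0. Qed.

Lemma lpoly_lbound_eq0 p : Defs.lbound (-1) (lpoly p) -> p = 0.
Proof.
move=> pb; apply/eqP; apply: contraT => /has_ldeg_lpoly[].
by rewrite pb ?eqxx //; lia.
Qed.

Lemma lfracE h : lfrac h = h - lpoly (lpolypart h).
Proof. by apply/eqP; rewrite eq_sym subr_eq addrC -lpart_decomp. Qed.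

Lemma lfrac_bound h : Defs.lbound (-1) (lfrac h).
Proof. by move=> i i1 /=; rewrite /lfrac_coef leNgt i1. Qed.

Lemma has_ldegV h d : has_ldeg h d -> has_ldeg h^-1 (- d).
Proof.
move=> hd; have h0 := has_ldeg_neq0 hd.
have /has_ldeg_ex[e he] : h^-1 != 0 by rewrite invr_eq0.
suff: d + e = 0 by move=> /eqP; rewrite addrC addr_eq0 => /eqP <-.
apply: (@has_ldeg_uniq 1); first by rewrite -(divff h0); apply: has_ldegM.
by have := has_ldeg_lpoly (oner_neq0 {poly F}); rewrite size_poly1 rmorph1.
Qed.

Lemma size_lpolypart h d : has_ldeg h d -> 0 <= d -> size (lpolypart h) = `|d|.+1.
Proof.
move=> hd d0.
have lo i : -1 < i -> (h - lfrac h) i = h i.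
  by move=> i1; rewrite /= /lfrac_coef leNgt i1 subr0.
have hp : has_ldeg (lpoly (lpolypart h)) d.
  have E : lpoly (lpolypart h) = h - lfrac h by rewrite {2}(lpart_decomp h) addrK.
  case: hd => [hd hb]; split=> [|i di].
    by rewrite E lo //; lia.
  by rewrite E lo ?hb //; lia.
have p0 : lpolypart h != 0.
  by apply: contraNneq (has_ldeg_neq0 hp) => ->; rewrite raddf0.
have := has_ldeg_uniq hp (has_ldeg_lpoly p0).
have : (0 < size (lpolypart h))%N by rewrite size_poly_gt0.
lia.
Qed.

End LaurentDegree.

(** * Digits and convergents *)

Section Digits.
Variable F : fieldType.
Implicit Types (h : laurent F).

(** Entry j is the coefficient of X^-(j+1); two elements of the unit ball share these m digits
    exactly when their distance is below q^-m. *)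
Definition digits m h : 'rV[F]_m := \row_(j < m) h (- (j.+1)%:Z).

Lemma digits_is_additive m : zmod_morphism (digits m).
Proof. by move=> g h; apply/rowP => j; rewrite !mxE. Qed.
HB.instance Definition _ m :=
  GRing.isZmodMorphism.Build (laurent F) 'rV[F]_m (digits m) (@digits_is_additive m).

Lemma digits_lfrac m h : digits m (lfrac h) = digits m h.
Proof. by apply/rowP => j; rewrite !mxE. Qed.

Lemma digits_eq0P m h : digits m h = 0 <-> Defs.lbound (- m%:Z - 1) (lfrac h).
Proof.
rewrite -digits_lfrac; split=> [/rowP z i mi|b]; last first.
  by apply/rowP => j; rewrite mxE b ?mxE //; have := ltn_ord j; lia.
have [i1|i1] := ltP (-1) i; first exact: lfrac_bound.
have im : (`|i|.-1 < m)%N by lia.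
have := z (Ordinal im); rewrite !mxE /= => <-.
by congr lfrac_coef; lia.
Qed.

Lemma digits_eqP m g h :
  digits m g = digits m h <-> forall i : nat, (i < m)%N -> g (- i.+1%:Z) = h (- i.+1%:Z).
Proof.
split=> [/rowP E i im|E]; first by have := E (Ordinal im); rewrite !mxE.
by apply/rowP => j; rewrite !mxE E.
Qed.

Lemma digits_leq m m' g h : (m <= m')%N -> digits m' g = digits m' h ->
  digits m g = digits m h.
Proof.
move=> mm' /digits_eqP E; apply/digits_eqP => i im; apply: E.
exact: leq_trans mm'.
Qed.

End Digits.

(** * Continued fraction remainders and best approximation *)

Section Convergents.
Variables (F : fieldType) (f : laurent F).
Hypothesis f_irrational : lirrational f.

Local Notation num := (convergent_num f).
Local Notation den := (convergent_den f).
Local Notation c := (convergent_deg f).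
Local Notation theta k := (lfrac (complete_quotient f k)).

Definition remainder k : laurent F := lpoly (den k) * f - lpoly (num k).
Local Notation D := remainder.

Lemma remainder_neq0 k : den k != 0 -> D k != 0.
Proof.
move=> d0; apply/eqP => D0; apply: f_irrational; exists (num k), (den k).
split=> //; apply: (canRL (mulfK (lpoly_neq0 d0))).
by rewrite mulrC; apply/eqP; rewrite -subr_eq0; apply/eqP.
Qed.

Lemma lpoly_partial_quotient k :
  lpoly (partial_quotient f k) = complete_quotient f k - theta k.
Proof. by rewrite lfracE opprB addrC subrK. Qed.

(** The next complete quotient is the inverse of theta_k, so its degree e is positive and is carried
    by its polynomial part. *)
Lemma theta_deg k : theta k != 0 -> exists e : nat,
  [/\ (0 < e)%N, has_ldeg (theta k) (- e%:Z) & size (partial_quotient f k.+1) = e.+1].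
Proof.
move=> /has_ldeg_ex[d td]; have d0 : d <= -1.
  by rewrite leNgt; apply/negP => d1; case: td => /eqP[]; apply: lfrac_bound.
exists `|d|%N; have dE : - (`|d|%N)%:Z = d by lia.
split; [lia | by rewrite dE |].
have /= := has_ldegV td; rewrite -[_^-1]/(complete_quotient f k.+1) => /size_lpolypart ->; lia.
Qed.

Lemma remainder0 : D 0 = theta 0.
Proof. by rewrite /D /= rmorph1 mul1r lfracE. Qed.

Lemma remainder1 : theta 0 != 0 -> D 1 = - theta 1 * D 0.
Proof.
move=> t0; rewrite remainder0 /D /= rmorphD rmorph1 rmorphM /=.
have -> : lpoly (partial_quotient f 0) = f - theta 0 by rewrite lpoly_partial_quotient.
rewrite mulrBr opprD opprB addrA addrCA subrr addr0 lpoly_partial_quotient /=.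
by rewrite mulrBl mulVf // mulNr addrAC subrr add0r.
Qed.

Lemma remainderSS k : D k.+2 = lpoly (partial_quotient f k.+2) * D k.+1 + D k.
Proof. by rewrite /D !rmorphD !rmorphM /= mulrDl mulrBr opprD !mulrA addrACA. Qed.

(** Irrationality keeps every D_k nonzero, hence theta_(k+1) too, so the expansion never stops. If
    theta_(k+1) has degree -e, then passing to the next index raises the degree of the denominator
    by e and lowers the degree of the remainder by e. *)
Lemma convergent_invariant k :
  [/\ den k != 0, den k.+1 != 0, (c k < c k.+1)%N,
      has_ldeg (D k) (- (c k.+1)%:Z) & D k.+1 = - theta k.+1 * D k].
Proof.
elim: k => [|k [dk dk1 cc Dk DkE]].
  have d0 : den 0 != 0 by exact: oner_neq0.
  have t0 : theta 0 != 0 by rewrite -remainder0 remainder_neq0.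
  have [e [e0 te se]] := theta_deg t0.
  rewrite remainder1 // remainder0 /convergent_deg /= size_poly1 se.
  by split=> //; rewrite -size_poly_gt0 se.
have Dk1 := remainder_neq0 dk1.
have t1 : theta k.+1 != 0.
  by apply: contraNneq Dk1 => t0; rewrite DkE t0 oppr0 mul0r.
have [e [e0 te se]] := theta_deg t1.
have sdk : size (den k) = (c k).+1 by rewrite /convergent_deg prednK // size_poly_gt0.
have sdk1 : size (den k.+1) = (c k.+1).+1.
  by rewrite /convergent_deg prednK // size_poly_gt0.
have a0 : partial_quotient f k.+2 != 0 by rewrite -size_poly_gt0 se.
have sM : size (partial_quotient f k.+2 * den k.+1) = (e + c k.+1).+1.
  by rewrite size_mul // se sdk1; lia.
have sdk2 : size (den k.+2) = (e + c k.+1).+1.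
  rewrite -[den k.+2]/(partial_quotient f k.+2 * den k.+1 + den k).
  by rewrite size_polyDl sM // sdk; lia.
have ck2 : c k.+2 = (e + c k.+1)%N by rewrite {1}/convergent_deg sdk2.
split=> //; first by rewrite -size_poly_gt0 sdk2.
- by rewrite ck2; lia.
- rewrite DkE ck2 PoszD opprD mulNr; apply: has_ldegN; exact: has_ldegM.
(* Since f_(k+2) = 1 / theta_(k+1), the term f_(k+2) D_(k+1) cancels D_k in the recurrence and only
   -theta_(k+2) D_(k+1) is left. *)
- have E : complete_quotient f k.+2 * D k.+1 = - D k.
    by rewrite DkE /= mulNr mulrN mulrA mulVf // mul1r.
  rewrite remainderSS lpoly_partial_quotient mulrBl E.
  by rewrite addrAC addNr add0r mulNr.
Qed.

Lemma den_neq0 k : den k != 0.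
Proof. by case: (convergent_invariant k). Qed.

Lemma convergent_deg0 : c 0 = 0%N.
Proof. by rewrite /convergent_deg size_poly1. Qed.

Lemma convergent_deg_lt k : (c k < c k.+1)%N.
Proof. by case: (convergent_invariant k). Qed.

Lemma convergent_deg_mono : {homo c : i j / (i <= j)%N}.
Proof. by apply: homo_leq leq_trans _ => // k; rewrite ltnW ?convergent_deg_lt. Qed.

Lemma leq_convergent_deg k : (k <= c k)%N.
Proof. by elim: k => // k IH; exact: leq_ltn_trans IH (convergent_deg_lt k). Qed.

Lemma size_den k : size (den k) = (c k).+1.
Proof. by rewrite /convergent_deg prednK // size_poly_gt0 den_neq0. Qed.

Lemma has_ldeg_remainder k : has_ldeg (D k) (- (c k.+1)%:Z).
Proof. by case: (convergent_invariant k). Qed.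

Lemma lcoefD (g h : laurent F) i : (g + h) i = g i + h i.
Proof. by []. Qed.

Lemma lcoefB (g h : laurent F) i : (g - h) i = g i - h i.
Proof. by []. Qed.

Lemma lboundM (g h : laurent F) d e :
  Defs.lbound d g -> Defs.lbound e h -> Defs.lbound (d + e) (g * h).
Proof. exact: lconv_bound. Qed.

(** Descent on k: a counterexample at k+1 satisfies Q D_k = Q_k {Qf}, and comparing degrees makes it
    a counterexample at k. *)
Lemma best_approximation k (Q : {poly F}) :
  Q != 0 -> (size Q <= c k)%N -> digits (c k) (lpoly Q * f) <> 0.
Proof.
move=> Q0; elim: k => [|k IH] sQ; first by rewrite leqNgt convergent_deg0 size_poly_gt0 Q0 in sQ.
move=> /digits_eq0P; set E := lfrac _ => Eb.
have EE : lpoly Q * f - E = lpoly (lpolypart (lpoly Q * f)).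
  by rewrite /E lfracE opprB addrC subrK.
(* Both terms on the left have degree < 0, so this polynomial vanishes. *)
have cross : lpoly Q * D k - lpoly (den k) * E =
    lpoly (den k * lpolypart (lpoly Q * f) - Q * num k).
  rewrite rmorphB !rmorphM /= -EE /D !mulrBr !mulrA [lpoly (den k) * lpoly Q]mulrC.
  by rewrite addrAC.
have sQ0 : (0 < size Q)%N by rewrite size_poly_gt0.
have QD := has_ldegM (has_ldeg_lpoly Q0) (has_ldeg_remainder k).
have dk := has_ldeg_lpoly (den_neq0 k); rewrite size_den /= in dk.
have lt := convergent_deg_lt k.
have /lpoly_lbound_eq0 z : Defs.lbound (-1) (lpoly (den k * lpolypart (lpoly Q * f) - Q * num k)).
  rewrite -cross => i i1; rewrite lcoefB QD.2 ?(lboundM dk.2 Eb) ?subrr //; lia.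
move: cross; rewrite z raddf0 => /eqP; rewrite subr_eq0 => /eqP QDE.
have E0 : E != 0.
  by apply/eqP => E0; move: QDE; rewrite E0 mulr0 => /eqP; apply/negP/(has_ldeg_neq0 QD).
have [e Ee] := has_ldeg_ex E0.
have e_le : e <= - (c k.+1)%:Z - 1.
  by rewrite leNgt; apply/negP => ?; case: Ee => /eqP[]; apply: Eb.
have dkE := has_ldegM dk Ee; rewrite -QDE in dkE.
(* deg Q - n_(k+1) = n_k + e with e < -n_(k+1), so deg Q < n_k. *)
have sE := has_ldeg_uniq QD dkE.
apply: IH; first by lia.
by apply/digits_eq0P; apply: lboundW Eb; lia.
Qed.

(** A Q_k f differs from the polynomial A P_k by A D_k, whose degree is below -l. The subtraction is
    truncated: for l >= n_(k+1) the bound forces A = 0. *)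
Lemma digits_mul_den k l (A : {poly F}) : (size A <= c k.+1 - l)%N ->
  digits l (lpoly (A * den k) * f) = 0.
Proof.
move=> sA; have [->|A0] := eqVneq A 0; first by rewrite mul0r raddf0 mul0r raddf0.
have -> : lpoly (A * den k) * f = lpoly (A * num k) + lpoly A * D k.
  by rewrite !rmorphM /= -mulrA -mulrDr /D addrC subrK.
have AD := (has_ldegM (has_ldeg_lpoly A0) (has_ldeg_remainder k)).2.
have A1 : (0 < size A)%N by rewrite size_poly_gt0.
apply/rowP => j; rewrite !mxE lcoefD AD ?addr0 //.
by have := ltn_ord j; lia.
Qed.

End Convergents.

(** * Counting digits *)

(** Translation by a preimage of w - v matches the fibre over v with the fibre over w, so all fibres
    have the same size. *)
Lemma sum_fiber (U V : finZmodType) (phi : U -> V) (v : V) :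
  zmod_morphism phi -> (forall v, exists u, phi u = v) ->
  ((\sum_u (phi u == v)) * #|V|)%N = #|U|.
Proof.
move=> phiB phi_surj.
have fib w : (\sum_u (phi u == w) = \sum_u (phi u == v))%N.
  have [u uE] := phi_surj (w - v).
  have bij : bijective (fun x : U => x + u).
    by exists (fun x => x - u) => x; rewrite ?addrK ?subrK.
  rewrite (reindex _ (onW_bij _ bij)); apply: eq_bigr => x _.
  have -> : phi (x + u) = phi x + (w - v).
    by rewrite -[u in LHS]opprK phiB -[- u]sub0r phiB uE -(subrr u) phiB subrr sub0r opprK.
  by rewrite addrCA -[X in _ == X]addr0 (inj_eq (addrI w)) subr_eq0.
transitivity (\sum_w \sum_u (phi u == w))%N.
  by rewrite (eq_bigr _ (fun w _ => fib w)) sum_nat_const mulnC.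
rewrite exchange_big /= -sum1_card; apply: eq_bigr => u _.
by rewrite (bigD1 (phi u)) //= eqxx big1 // => w; rewrite eq_sym => /negPf ->.
Qed.

Section Counting.
Variables (F : finFieldType).
Implicit Types (h : laurent F).

Section Fill.
Variables (M : nat) (w : 'rV[F]_M).

Definition fill_coef (i : int) : F :=
  \sum_(j < M) if i == - j.+1%:Z then w 0 j else 0.
Fact fill_bound : Defs.lbound (-1) fill_coef.
Proof. by move=> i i1; apply: big1 => j _; rewrite ifF //; lia. Qed.
Fact fill_bounded : exists d, Defs.lbound d fill_coef.
Proof. by exists (-1); exact: fill_bound. Qed.

(** The representative of the cylinder of [w] whose digits beyond M are zero; it turns averages over
    the ball into finite sums over words. *)
Definition fill := Laurent fill_bounded.

Lemma fill_lball : fill \in in_lball (F:=F).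
Proof. exact/in_lballP/fill_bound. Qed.

Lemma digits_fill : digits M fill = w.
Proof.
apply/rowP => i; rewrite !mxE /= /fill_coef (bigD1 i) //= eqxx big1 ?addr0 // => j ji.
by rewrite ifF //; apply: contraNF ji => /eqP ij; apply/eqP/val_inj => /=; lia.
Qed.

End Fill.

Lemma fill_is_additive M : zmod_morphism (@fill M).
Proof.
move=> v w; apply: laurentP => i /=; rewrite /fill_coef -sumrN -big_split /=.
by apply: eq_bigr => j _; case: ifP; rewrite ?mxE ?subr0.
Qed.

Lemma sum_digits_fill M s (v : 'rV[F]_s) : (s <= M)%N ->
  ((\sum_(w : 'rV[F]_M) (digits s (fill w) == v)) * #|F| ^ s)%N = (#|F| ^ M)%N.
Proof.
move=> sM; have := @sum_fiber 'rV[F]_M 'rV[F]_s (fun w => digits s (fill w)) v.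
rewrite !card_mx !mul1n; apply=> [u w|u]; first by rewrite fill_is_additive raddfB.
exists (digits M (fill u)); rewrite -[RHS]digits_fill.
by apply: digits_leq sM _; rewrite digits_fill.
Qed.

(** Pairs with nonzero first component parametrize the polynomials of degree exactly j; the
    nonvanishing is imposed in each sum. *)
Definition poly_lead j (x : F * 'rV[F]_j) : {poly F} := x.1 *: 'X^j + rVpoly x.2.

Lemma size_rVpoly n (u : 'rV[F]_n) : (size (rVpoly u) <= n)%N.
Proof. exact: size_poly. Qed.

Lemma size_poly_lead j (x : F * 'rV[F]_j) : x.1 != 0 -> size (poly_lead x) = j.+1.
Proof.
by move=> x0; rewrite size_polyDl size_scale // size_polyXn // ltnS size_rVpoly.
Qed.

Lemma poly_lead_inj j : injective (@poly_lead j).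
Proof.
move=> [a u] [b v] E.
have cf i (x : F * 'rV[F]_j) : (poly_lead x)`_i = x.1 *+ (i == j) + (rVpoly x.2)`_i.
  by rewrite coefD coefZ coefXn mulr_natr.
have ab : a = b.
  have := congr1 (fun p : {poly F} => p`_j) E; rewrite !cf eqxx !mulr1n /=.
  by rewrite !nth_default ?size_rVpoly // !addr0.
rewrite ab in E *; congr pair; apply: (can_inj rVpolyK).
by apply: (addrI (b *: 'X^j)).
Qed.

End Counting.

(** * Second moment of the number of hits *)

Section SecondMoment.
Variables (R : realFieldType) (F : finFieldType) (f : laurent F).
(** To be instantiated with c k = n_k, [blk n] the index k such that n_k <= n < n_(k+1), and m n =
    max(n_(k+1), l_n). *)
Variables (c : nat -> nat) (blk m : nat -> nat).
Hypothesis best : forall k (Q : {poly F}),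
  Q != 0 -> (size Q <= c k)%N -> digits (c k) (lpoly Q * f) <> 0.
Hypothesis c_lt : forall k, (c k < c k.+1)%N.
Hypothesis blkP : forall n, (c (blk n) <= n < c (blk n).+1)%N.
Hypothesis m_mono : {homo m : i j / (i <= j)%N}.
Hypothesis m_ge : forall n, (c (blk n).+1 <= m n)%N.

Lemma blk_eq n k : (c k <= n < c k.+1)%N -> blk n = k.
Proof.
have c_mono : {homo c : i j / (i <= j)%N} by apply: homo_leq leq_trans _ => // k'; exact: ltnW.
have /andP[b1 b2] := blkP n; move=> /andP[k1 k2].
by have [/c_mono|/c_mono|//] := ltngtP (blk n) k; lia.
Qed.

Local Notation q := (#|F|%:R : R).

Definition orbit_digits s (Q : {poly F}) : 'rV[F]_s := digits s (lpoly Q * f).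

Lemma orbit_digits_is_additive s : zmod_morphism (orbit_digits s).
Proof. by move=> Q Q'; rewrite /orbit_digits !raddfB mulrBl raddfB. Qed.
HB.instance Definition _ s := GRing.isZmodMorphism.Build
  {poly F} 'rV[F]_s (orbit_digits s) (orbit_digits_is_additive s).

Lemma q_gt1 : 1 < q.
Proof. by rewrite ltr1n card_finNzRing_gt1. Qed.
Lemma q_gt0 : 0 < q. Proof. exact: lt_trans ltr01 q_gt1. Qed.
Lemma qX_gt0 n : 0 < q ^+ n. Proof. exact: exprn_gt0 q_gt0. Qed.
Lemma qX_ge0 n : 0 <= q ^+ n. Proof. exact: ltW (qX_gt0 n). Qed.
Lemma qX_neq0 n : q ^+ n != 0. Proof. by rewrite gt_eqF ?qX_gt0. Qed.
Lemma q1_ge0 : 0 <= q - 1. Proof. by rewrite subr_ge0 ltW ?q_gt1. Qed.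

(** Equidistribution up to depth n_k: Q -> digits of Qf is additive, and it is already onto when
    restricted to degrees below n_k, so all fibres are equal. *)
Lemma sum_orbit_digits k N s (v : 'rV[F]_s) : (s <= c k)%N -> (c k <= N)%N ->
  \sum_(u : 'rV[F]_N) (orbit_digits s (rVpoly u) == v)%:R = q ^+ N / q ^+ s.
Proof.
move=> sc cN; apply: (canRL (mulfK (qX_neq0 s))).
have := @sum_fiber 'rV[F]_N 'rV[F]_s (fun u => orbit_digits s (rVpoly u)) v.
rewrite !card_mx !mul1n => E; rewrite -natr_sum -!natrX -natrM E // => [x y|y].
  by rewrite !raddfB.
(* Best approximation gives injectivity from words of length n_k to words of length n_k; finiteness
   then gives surjectivity. *)
have inj : injective (fun u : 'rV[F]_(c k) => orbit_digits (c k) (rVpoly u)).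
  move=> x x' /eqP; rewrite -subr_eq0 -!raddfB => /eqP xy; apply/eqP.
  rewrite -subr_eq0 -(inj_eq (can_inj rVpolyK)) raddf0; apply: contraPT xy => xy0.
  exact: best xy0 (size_rVpoly _).
have [g _ gK] := injF_bij inj.
pose p := rVpoly (g (digits (c k) (fill y))).
exists (poly_rV p); rewrite poly_rV_K ?(leq_trans (size_rVpoly _)) //.
rewrite -[RHS]digits_fill; apply: digits_leq sc _; exact: gK.
Qed.

Lemma sum_leads j (E : F * 'rV[F]_j -> R) :
  \sum_(x : F * 'rV[F]_j | x.1 != 0) E x = \sum_(a : F | a != 0) \sum_u E (a, u).
Proof. by rewrite pair_big; apply: eq_big => [[a u]|[a u] _] //=; rewrite andbT. Qed.

(** For each leading coefficient a, the term a X^j only translates the target word. *)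
Lemma sum_orbit_digits_lead k j s (v : 'rV[F]_s) : (s <= c k)%N -> (c k <= j)%N ->
  \sum_(x : F * 'rV[F]_j | x.1 != 0) (orbit_digits s (poly_lead x) == v)%:R
  = (q - 1) * (q ^+ j / q ^+ s).
Proof.
move=> sc cj.
rewrite sum_leads.
rewrite (eq_bigr (fun=> q ^+ j / q ^+ s)) => [|a _].
  rewrite sumr_const -[LHS]mulr_natl; congr (_ * _).
  by rewrite cardC1 -subn1 natrB // ltnW // card_finNzRing_gt1.
rewrite -(sum_orbit_digits (v - orbit_digits s (a *: 'X^j)) sc cj).
by apply: eq_bigr => u _; rewrite raddfD /= addrC -[in RHS]subr_eq0 opprB addrA subr_eq0.
Qed.

Lemma card_leads j : \sum_(x : F * 'rV[F]_j | x.1 != 0) (1 : R) = (q - 1) * q ^+ j.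
Proof.
rewrite sum_leads.
rewrite (eq_bigr (fun=> q ^+ j)) => [|a _].
  rewrite sumr_const cardC1 -[LHS]mulr_natl; congr (_ * _).
  by rewrite -subn1 natrB // ltnW // card_finNzRing_gt1.
by rewrite sumr_const card_mx mul1n natrX.
Qed.

Lemma orbit_digits_inj k (Q Q' : {poly F}) s : (size Q <= c k)%N -> (size Q' <= c k)%N ->
  (c k <= s)%N -> orbit_digits s Q = orbit_digits s Q' -> Q = Q'.
Proof.
move=> sQ sQ' cs /(digits_leq cs) /eqP; rewrite -subr_eq0 -raddfB -mulrBl -raddfB.
move=> /eqP z; apply/eqP; rewrite -subr_eq0; apply: contraPT z => z.
apply: best z _; by rewrite (leq_trans (size_polyD _ _)) // size_polyN geq_max sQ.
Qed.

Definition hits M j (w : 'rV[F]_M) : R := \sum_(x : F * 'rV[F]_j | x.1 != 0)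
  (orbit_digits (m j) (poly_lead x) == digits (m j) (fill w))%:R.

(** The mean of [hits j] when m j <= M: there are (q-1) q^j polynomials of degree j, and each is hit
    with probability q^-(m j). *)
Definition weight j : R := (q - 1) * q ^+ j / q ^+ m j.

Lemma weight_ge0 j : 0 <= weight j.
Proof. by rewrite divr_ge0 ?mulr_ge0 ?q1_ge0 ?qX_ge0. Qed.

Lemma sum_digits_fillR M s (v : 'rV[F]_s) : (s <= M)%N ->
  \sum_(w : 'rV[F]_M) (v == digits s (fill w))%:R = q ^+ M / q ^+ s.
Proof.
move=> sM; apply: (canRL (mulfK (qX_neq0 s))).
rewrite -!natrX -(sum_digits_fill v sM) natrM natr_sum; congr (_ * _).
by apply: eq_bigr => w _; rewrite eq_sym.
Qed.

Lemma sum_hits M j : (m j <= M)%N ->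
  \sum_(w : 'rV[F]_M) hits j w = q ^+ M * weight j.
Proof.
move=> mM; rewrite exchange_big /=.
rewrite (eq_bigr (fun=> 1 * (q ^+ M / q ^+ m j))) => [|x _].
  by rewrite -mulr_suml card_leads /weight mulrCA mulrA.
by rewrite sum_digits_fillR // mul1r.
Qed.

(** The count is 0 or 1: polynomials of degree j have size at most n_(k+1) <= m j, with k the block
    of j, so they are separated by their first m j digits. *)
Lemma hits_sqr M j (w : 'rV[F]_M) : hits j w ^+ 2 = hits j w.
Proof.
rewrite expr2 {2 3}/hits mulr_sumr; apply: eq_bigr => x x0.
case: eqP => [xw|_]; last by rewrite mulr0.
rewrite mulr1 /hits (bigD1 x) //= -xw eqxx big1 ?addr0 // => y /andP[y0 yx].
case: eqP => // yxw; case/eqP: yx; apply: poly_lead_inj.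
have /andP[_ jc] := blkP j.
by apply: orbit_digits_inj (m_ge j) yxw; rewrite size_poly_lead.
Qed.

(** Allowance for dependence between degrees i < j in different blocks, when m i exceeds n_k for k
    the block of j: each of the (q-1) q^i polynomials then contributes at most q^-n_k times
    [weight j]. *)
Definition overlap i j : R :=
  if (i < c (blk j))%N then (q - 1) * q ^+ i / q ^+ c (blk j) * weight j else 0.

(* Fix the polynomial of degree [i] and let that of degree [j] vary.  At depth at
   most [c (blk j)] the orbit of the latter is exactly equidistributed; at larger
   depth its digits are only bounded by those at depth [c (blk j)]; and if [i] is
   in the same block as [j], best approximation rules out any coincidence. *)
Lemma sum_hits_prod M i j : (i < j)%N -> (m j <= M)%N ->
  \sum_(w : 'rV[F]_M) hits i w * hits j w
    <= q ^+ M * (weight i * weight j + overlap i j).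
Proof.
move=> ij mM; have mij := m_mono (ltnW ij).
(* A word hit by both polynomials exists only if their orbits agree to the smaller depth m i; in
   that case q^(M - m j) words are hit. *)
have prodE : \sum_(w : 'rV[F]_M) hits i w * hits j w =
    \sum_(x : F * 'rV[F]_i | x.1 != 0) \sum_(y : F * 'rV[F]_j | y.1 != 0)
      (orbit_digits (m i) (poly_lead y) == orbit_digits (m i) (poly_lead x))%:R
      * (q ^+ M / q ^+ m j).
  under eq_bigr do rewrite /hits mulr_suml.
  rewrite exchange_big /=; apply: eq_bigr => x _.
  under eq_bigr do rewrite mulr_sumr.
  rewrite exchange_big /=; apply: eq_bigr => y _.
  rewrite -(sum_digits_fillR (orbit_digits (m j) (poly_lead y)) mM) mulr_sumr.
  apply: eq_bigr => w _; case: (orbit_digits (m j) _ =P _) => [E|]; last by rewrite !mulr0.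
  rewrite !mulr1 eq_sym; congr (_ == _)%:R.
  by apply/esym/(digits_leq mij).
rewrite {}prodE.
pose cnt (x : F * 'rV[F]_i) : R := \sum_(y : F * 'rV[F]_j | y.1 != 0)
  (orbit_digits (m i) (poly_lead y) == orbit_digits (m i) (poly_lead x))%:R.
have bound (K : R) : (forall x : F * 'rV[F]_i, x.1 != 0 -> cnt x <= K) ->
    \sum_(x : F * 'rV[F]_i | x.1 != 0) cnt x * (q ^+ M / q ^+ m j)
    <= (q - 1) * q ^+ i * K * (q ^+ M / q ^+ m j).
  move=> cK; rewrite -mulr_suml ler_wpM2r ?divr_ge0 ?qX_ge0 //.
  rewrite -card_leads mulr_suml; apply: ler_sum => x x0; rewrite mul1r; exact: cK.
under eq_bigr do rewrite -mulr_suml -/(cnt _).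
have /andP[cj jc] := blkP j.
have over0 : 0 <= overlap i j.
  rewrite /overlap; case: ifP => // _.
  by rewrite mulr_ge0 ?weight_ge0 // divr_ge0 ?mulr_ge0 ?q1_ge0 ?qX_ge0.
have [mic|cmi] := leqP (m i) (c (blk j)).
  apply: le_trans (bound ((q - 1) * (q ^+ j / q ^+ m i)) _) _.
    by move=> x _; rewrite /cnt (sum_orbit_digits_lead _ mic).
  rewrite mulrDr; apply: ler_wpDr; first by rewrite mulr_ge0 ?qX_ge0.
  rewrite le_eqVlt; apply/orP; left.
  apply/eqP; rewrite /weight; field; by rewrite !qX_neq0.
have [ic|ci] := ltnP i (c (blk j)).
  apply: le_trans (bound ((q - 1) * (q ^+ j / q ^+ c (blk j))) _) _.
    move=> x _; rewrite -(@sum_orbit_digits_lead (blk j) j _ (orbit_digits _ (poly_lead x))) //.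
    rewrite /cnt; apply: ler_sum => y _; rewrite ler_nat; case: eqP => // E.
    by rewrite [orbit_digits _ (poly_lead y)](digits_leq (ltnW cmi) E) eqxx.
  have ww : 0 <= q ^+ M * (weight i * weight j).
    exact: mulr_ge0 (qX_ge0 _) (mulr_ge0 (weight_ge0 _) (weight_ge0 _)).
  rewrite mulrDr; apply: ler_wpDl => //.
  rewrite /overlap ic le_eqVlt; apply/orP; left.
  apply/eqP; rewrite /weight; field; by rewrite !qX_neq0.
apply: le_trans (bound 0 _) _.
  move=> x x0; rewrite /cnt big1 // => y y0; case: eqP => // E.
  have cm : (c (blk j).+1 <= m i)%N.
    suff <- : blk i = blk j by [].
    by apply: blk_eq; rewrite ci (ltn_trans ij).
  have := congr1 (fun p : {poly F} => size p) (orbit_digits_inj _ _ cm E).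
  by rewrite !size_poly_lead //; lia.
rewrite mulr0 mul0r; apply: mulr_ge0 (qX_ge0 _) (addr_ge0 _ over0).
exact: mulr_ge0 (weight_ge0 _) (weight_ge0 _).
Qed.

(** Geometric series: the (q-1) q^i with i < n_k add up to q^n_k - 1, where k is the block of N. *)
Lemma sum_overlap N0 N : \sum_(N0 <= i < N) overlap i N <= weight N.
Proof.
have ov i : 0 <= overlap i N.
  rewrite /overlap; case: ifP => // _.
  by rewrite mulr_ge0 ?weight_ge0 // divr_ge0 ?mulr_ge0 ?q1_ge0 ?qX_ge0.
have /andP[cN _] := blkP N.
apply: (@le_trans _ _ (\sum_(i < c (blk N)) (q - 1) * q ^+ i / q ^+ c (blk N) * weight N)).
  apply: (@le_trans _ _ (\sum_(0 <= i < N) overlap i N)).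
    have [NN|NN] := leqP N N0; first by rewrite (big_geq NN) sumr_ge0.
    by rewrite [leRHS](big_cat_nat (n := N0)) //= 1?ltnW // lerDr sumr_ge0.
  rewrite -(big_mkord xpredT (fun i => (q - 1) * q ^+ i / q ^+ c (blk N) * weight N)).
  rewrite (big_nat_widen _ _ N) // [leRHS]big_mkcond /=.
  by apply: ler_sum => i _.
rewrite -!mulr_suml -mulr_sumr -subrX1 ler_piMl ?weight_ge0 //.
by rewrite ler_pdivrMr ?qX_gt0 // mul1r gerBl.
Qed.

Definition total_hits N0 N M (w : 'rV[F]_M) : R := \sum_(N0 <= j < N) hits j w.

Definition total_weight N0 N : R := \sum_(N0 <= j < N) weight j.

Lemma sum_total_hits N0 N M : (forall j, (j < N)%N -> (m j <= M)%N) ->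
  \sum_(w : 'rV[F]_M) total_hits N0 N w = q ^+ M * total_weight N0 N.
Proof.
move=> mM; rewrite exchange_big /= mulr_sumr; apply: eq_big_nat => j /andP[_ jN].
exact/sum_hits/mM.
Qed.

(** Adding degree N, of weight w, increases the second moment by twice the cross term, at most 2(ew
    + w), plus w because the new count is its own square; hence the constant 3. *)
Lemma sum_total_hits_sqr N0 N M : (forall j, (j < N)%N -> (m j <= M)%N) ->
  let e := total_weight N0 N in
  \sum_(w : 'rV[F]_M) total_hits N0 N w ^+ 2 <= q ^+ M * (e ^+ 2 + 3 * e).
Proof.
elim: N => [|N IH] mM /=.
  rewrite /total_weight big_geq // big1 => [|w _]; last by rewrite /total_hits big_geq // expr0n.
  by rewrite expr0n mulr0 addr0 mulr0.
have [NN|NN] := ltnP N N0.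
  rewrite /total_weight big_geq // big1 => [|w _]; last by rewrite /total_hits big_geq // expr0n.
  by rewrite expr0n mulr0 addr0 mulr0.
have mM' j : (j < N)%N -> (m j <= M)%N by move=> jN; apply: mM; rewrite ltnS ltnW.
have {IH} := IH mM'; set e := total_weight N0 N => /= IH.
have -> : total_weight N0 N.+1 = e + weight N by rewrite /total_weight big_nat_recr.
under eq_bigr do rewrite /total_hits big_nat_recr //= -/(total_hits N0 N _) sqrrD hits_sqr.
rewrite !big_split /= sum_hits ?mM //.
have cross : \sum_(w : 'rV[F]_M) total_hits N0 N w * hits N w
    <= q ^+ M * (e * weight N + weight N).
  under eq_bigr do rewrite /total_hits mulr_suml.
  rewrite exchange_big /=.
  apply: (@le_trans _ _ (\sum_(N0 <= i < N) q ^+ M * (weight i * weight N + overlap i N))).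
    by apply: ler_sum_nat => i /andP[_ iN]; apply: sum_hits_prod (mM _ _).
  rewrite -mulr_sumr ler_wpM2l ?qX_ge0 // big_split /= -mulr_suml lerD2l.
  exact: sum_overlap.
apply: le_trans (lerD (lerD IH (lerD cross cross)) (lexx _)) _.
rewrite -!mulrDr ler_wpM2l ?qX_ge0 //.
have := weight_ge0 N; have := sqr_ge0 (weight N); nra.
Qed.

(* Chebyshev's inequality. *)
Lemma no_hit_bound N0 N M : (forall j, (j < N)%N -> (m j <= M)%N) ->
  0 < total_weight N0 N ->
  \sum_(w : 'rV[F]_M) (total_hits N0 N w == 0)%:R
    <= q ^+ M * (3 / total_weight N0 N).
Proof.
move=> mM; have sq := sum_total_hits_sqr N0 mM; have s1 := sum_total_hits N0 mM.
move: sq s1; set e := total_weight N0 N => /= sq s1 e0.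
have : (\sum_(w : 'rV[F]_M) (total_hits N0 N w == 0)%:R) * e ^+ 2
    <= \sum_(w : 'rV[F]_M) (total_hits N0 N w - e) ^+ 2.
  rewrite mulr_suml; apply: ler_sum => w _; case: eqP => [->|_]; first by rewrite mul1r sub0r sqrrN.
  by rewrite mul0r sqr_ge0.
under [leRHS]eq_bigr do rewrite sqrrB.
rewrite !big_split /= sumrN sumrMnl -mulr_suml s1 sumr_const card_mx mul1n.
rewrite -[_ *+ (#|F| ^ M)]mulr_natl natrX => ub.
rewrite -(ler_pM2r (exprn_gt0 2 e0)); apply: le_trans ub _.
have -> : q ^+ M * (3 / e) * e ^+ 2 = q ^+ M * (e ^+ 2 + 3 * e) - q ^+ M * e ^+ 2.
  by field; rewrite gt_eqF.
move: sq; rewrite mulr2n; lra.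
Qed.

End SecondMoment.

(** * Haar measure of cylinders *)

Section Cylinders.
Variables (R : realType) (F : finFieldType) (mu : probability (lball_borel F) R).
Hypothesis mu_haar : is_haar mu.
Local Notation q := (#|F|%:R : R).

Definition cylinder M (P : pred 'rV[F]_M) : set (lball_borel F) :=
  [set g : lball F | P (digits M (lball_val g))].

(** Norms are integral powers of q, so the strict inequality means degree at most -l-1. *)
Lemma lnorm_ltP (h : laurent F) (l : nat) :
  lnorm h < (#|F|%:R ^+ l)^-1 <-> Defs.lbound (- l%:Z - 1) h.
Proof.
have q1 : (1 : rat) < #|F|%:R by rewrite ltr1n card_finNzRing_gt1.
have -> : ((#|F|%:R ^+ l)^-1 : rat) = #|F|%:R ^ (- l%:Z) by rewrite -exprnN.
rewrite /lnorm; have [->|h0] := eqVneq h 0.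
  by split=> // _; rewrite exprz_gt0 // (lt_trans ltr01).
have [hd hb] := ldegP h0; rewrite ltr_eXz2l //.
split=> [dl|b]; first by apply: lboundW hb; lia.
by rewrite ltNge; apply/negP => ld; case/eqP: hd; apply: b; lia.
Qed.

Lemma lball_valB (g h : lball F) : lball_val (g - h) = lball_val g - lball_val h.
Proof. by []. Qed.

Lemma lball_lnorm_ltP (g h : lball F) (l : nat) :
  lnorm (lball_val (h - g)) < (#|F|%:R ^+ l)^-1
  <-> digits l (lball_val h) = digits l (lball_val g).
Proof.
have E : lfrac (lball_val (h - g)) = lball_val (h - g).
  apply: laurentP => i; rewrite /= /lfrac_coef; case: leP => // i1.
  exact: (esym (elimT (in_lballP _) (valP (h - g : lball F)) i i1)).
rewrite lnorm_ltP -{1}E -digits_eq0P lball_valB raddfB /=; split=> [/eqP|->].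
  by rewrite subr_eq0 => /eqP.
by rewrite subrr.
Qed.

Lemma measurable_cylinder M (P : pred 'rV[F]_M) : measurable (cylinder P).
Proof.
apply: sub_sigma_algebra => g Pg; exists (#|F|%:R ^+ M)^-1.
  by rewrite invr_gt0 exprn_gt0 // ltr0n ltnW // card_finNzRing_gt1.
by move=> h /lball_lnorm_ltP E; rewrite /cylinder /= E.
Qed.

(** Translation by [fill w] carries the cylinder of the zero word onto that of [w]; this is where
    invariance enters. *)
Lemma measure_cylinder_translate M (w : 'rV[F]_M) :
  mu (cylinder (pred1 w)) = mu (cylinder (pred1 (0 : 'rV[F]_M))).
Proof.
rewrite -(mu_haar (LBall (fill_lball w)) (measurable_cylinder (pred1 0))); congr (mu _).
apply/seteqP; split=> g /=.
  rewrite {1}/cylinder /= => /eqP gw.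
  exists (g - LBall (fill_lball w)); last by rewrite addrC subrK.
  by rewrite /cylinder /= raddfB /= digits_fill gw subrr.
move=> [h]; rewrite {1}/cylinder /= => /eqP h0 <-.
by rewrite /cylinder /= raddfD /= digits_fill h0 addr0.
Qed.

Lemma measure_cylinder_sum M (P : pred 'rV[F]_M) :
  mu (cylinder P) = (\sum_(w : 'rV[F]_M | P w) mu (cylinder (pred1 w)))%E.
Proof.
have -> : cylinder P = \bigcup_(w in [set` P]) cylinder (pred1 w).
  apply/seteqP; split=> g /=; rewrite /cylinder /=.
    by move=> Pg; exists (digits M (lball_val g)) => /=.
  by move=> [w /= Pw /eqP ->].
rewrite measure_fin_bigcup //=.
- rewrite (fsbigE (enum P)) ?enum_uniq //.
  + rewrite big_enum_cond /=; apply: eq_bigl => w.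
    by rewrite mem_setE unfold_in andbb.
  + by move=> w /=; rewrite mem_enum.
  + by move=> w Pw; rewrite mem_enum => /negP[].
- by move=> v w _ _ [g []]; rewrite /cylinder /= => /eqP <- /eqP.
- by move=> w _; exact: measurable_cylinder.
Qed.

(** The q^M word cylinders have equal measure and partition a space of mass 1. *)
Lemma measure_cylinder M (P : pred 'rV[F]_M) :
  mu (cylinder P) = ((\sum_(w : 'rV[F]_M) (P w)%:R) / q ^+ M)%:E.
Proof.
have q0 : q ^+ M != 0 by rewrite expf_neq0 // pnatr_eq0 -lt0n ltnW // card_finNzRing_gt1.
set x := fine (mu (cylinder (pred1 (0 : 'rV[F]_M)))).
have xE : mu (cylinder (pred1 (0 : 'rV[F]_M))) = x%:E.
  by rewrite fineK // fin_num_measure //; exact: measurable_cylinder.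
have all_P (S : pred 'rV[F]_M) : mu (cylinder S) = ((\sum_(w : 'rV[F]_M) (S w)%:R) * x)%:E.
  rewrite measure_cylinder_sum (eq_bigr (fun=> x%:E)) => [|w _]; last first.
    by rewrite measure_cylinder_translate.
  rewrite sumEFin mulr_suml big_mkcond /=; congr (_%:E); apply: eq_bigr => w _.
  by case: (S w); rewrite ?mul1r ?mul0r.
rewrite all_P; congr (_ * _)%:E; apply: (mulfI q0); rewrite divff //.
have := all_P xpredT.
have -> : cylinder (xpredT : pred 'rV[F]_M) = setT by apply/seteqP; split.
rewrite probability_setT => -[/esym].
by rewrite sumr_const card_mx mul1n natrX.
Qed.

Lemma negligible_setT : ~ mu.-negligible [set: lball_borel F].
Proof.
move=> [A [mA A0 TA]]; have : A = setT by apply/seteqP; split.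
by move=> AT; move: A0; rewrite AT probability_setT => /eqP; rewrite onee_eq0.
Qed.

End Cylinders.

(** * The zero-one law *)

(** The intersection of the sets [C n] is a measurable null set containing [B]. *)
Lemma negligible_small d (T : measurableType d) (R : realType) (mu : {measure set T -> \bar R})
    (B : set T) :
  (forall n : nat, exists2 C, measurable C & B `<=` C /\ (mu C <= (n.+1%:R^-1)%:E)%E) ->
  mu.-negligible B.
Proof.
move=> small; have [C CP] : {C : nat -> set T & forall n,
    [/\ measurable (C n), B `<=` C n & (mu (C n) <= (n.+1%:R^-1)%:E)%E]}.
  apply: (@choice _ _ (fun n (C : set T) => [/\ measurable C, B `<=` C &
    (mu C <= (n.+1%:R^-1)%:E)%E])) => n.
  by have [C ? []] := small n; exists C.
have mC n : measurable (C n) by case: (CP n).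
have mI : measurable (\bigcap_n C n) by exact: bigcapT_measurable.
exists (\bigcap_n C n); split=> //; last by move=> x Bx n _; case: (CP n) => _ + _; apply.
apply/eqP; rewrite eq_le measure_ge0 andbT; apply/lee_addgt0Pr => e e0.
rewrite add0e; have [n ne] : exists n : nat, n.+1%:R^-1 < e.
  by have /ltr_add_invr[n] := e0; rewrite add0r => ne; exists n.
apply: (@le_trans _ _ (mu (C n))); first by apply: le_measure; rewrite ?inE //; apply: bigcap_inf.
by have [_ _ h] := CP n; apply: le_trans h _; rewrite lee_fin ltW.
Qed.

Section KhintchineGroshev.
Variables (R : realType) (F : finFieldType) (mu : probability (lball_borel F) R).
Hypothesis mu_haar : is_haar mu.
Variable l : nat -> nat.
Hypothesis l_mono : {homo l : m n / (m <= n)%N}.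
Variable f : lball F.
Hypothesis f_irrational : lirrational f.

Local Notation q := (#|F|%:R : R).
Local Notation c := (convergent_deg f).
Let c_lt := convergent_deg_lt f_irrational.
Let c_mono := convergent_deg_mono f_irrational.
Let c_ge := leq_convergent_deg f_irrational.

(** * Blocks of degrees and the series as a single sum over degrees *)

Lemma block_ex n : exists k, (c k <= n < c k.+1)%N.
Proof.
elim: n => [|n [k /andP[kn nk]]].
  by exists 0%N; rewrite convergent_deg0 (leq_trans _ (c_lt 0)).
have [nk1|kn1] := ltnP n.+1 (c k.+1); first by exists k; rewrite nk1 leqW.
by exists k.+1; rewrite kn1 (leq_ltn_trans nk (c_lt _)).
Qed.

Definition block n : nat := sval (cid (block_ex n)).

Lemma blockP n : (c (block n) <= n < c (block n).+1)%N.
Proof. by rewrite /block; case: cid. Qed.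

Lemma block_mono : {homo block : i j / (i <= j)%N}.
Proof.
move=> i j ij; rewrite leqNgt; apply/negP => /c_mono lt.
have /andP[bi _] := blockP i; have /andP[_ bj] := blockP j; lia.
Qed.

Lemma blockE n k : (c k <= n < c k.+1)%N -> block n = k.
Proof. exact: (blk_eq c_lt blockP). Qed.

Definition depth n : nat := maxn (c (block n).+1) (l n).

Lemma depth_mono : {homo depth : i j / (i <= j)%N}.
Proof.
by move=> i j ij; rewrite geq_max !leq_max c_mono ?ltnS ?block_mono //= l_mono ?orbT.
Qed.

Lemma depth_ge n : (c (block n).+1 <= depth n)%N.
Proof. exact: leq_maxl. Qed.

Definition term n : R := q ^+ n / q ^+ depth n.

Lemma term_ge0 n : 0 <= term n.
Proof. by rewrite divr_ge0 ?exprn_ge0. Qed.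

Definition block_sum k : R :=
  \sum_(c k <= n < c k.+1) q ^ (n%:Z - (maxn (c k.+1) (l n))%:Z).

Lemma sum_block_sum K : \sum_(0 <= k < K) block_sum k = \sum_(0 <= n < c K) term n.
Proof.
elim: K => [|K IH]; first by rewrite convergent_deg0 !big_geq.
rewrite big_nat_recr //= IH [RHS](big_cat_nat (n := c K)) ?(ltnW (c_lt K)) //=.
congr (_ + _); apply: eq_big_nat => n nK.
rewrite /term /depth (blockE nK) expfzDr ?exprnP ?exprnN //.
by rewrite gt_eqF ?q_gt0.
Qed.

Lemma block_sum_ge0 k : 0 <= block_sum k.
Proof. by apply: sumr_ge0 => n _; rewrite exprz_ge0. Qed.

(** K blocks add up to the terms of index below n_K, and n_K >= K; as all terms are nonnegative, the
    two families of partial sums are unbounded together. *)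
Lemma block_series_pinfty :
  (\sum_(0 <= k <oo) (block_sum k)%:E = +oo :> \bar R)%E <->
  forall A : R, exists N, A <= \sum_(0 <= n < N) term n.
Proof.
have b0 k : (0 <= k)%N -> true -> (0 <= (block_sum k)%:E :> \bar R)%E.
  by rewrite lee_fin block_sum_ge0.
split=> [S A|unb].
  apply: contrapT => /forallNP lt.
  suff : (\sum_(0 <= k <oo) (block_sum k)%:E <= A%:E :> \bar R)%E by rewrite S.
  apply: lime_le; first exact: is_cvg_nneseries.
  near=> K; rewrite sumEFin lee_fin sum_block_sum ltW // ltNge; apply/negP; exact: lt.
apply: eq_infty => A; have [N AN] := unb A.
apply: (@le_trans _ _ (\sum_(0 <= k < N) (block_sum k)%:E)%E); last exact: nneseries_lim_ge.
rewrite sumEFin lee_fin sum_block_sum (le_trans AN) //.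
rewrite [leRHS](big_cat_nat (n := N)) ?c_ge //= lerDl.
by apply: sumr_ge0 => n _; exact: term_ge0.
Unshelve. all: by end_near. Qed.

Definition approx_set (g : lball F) : set {poly F} :=
  [set Q : {poly F} | exists n : nat, size Q = n.+1 /\
    lnorm (lfrac (lpoly Q * (f : laurent F)) - lball_val g) < (#|F|%:R ^+ l n)^-1].

(** {Qf} and g both lie in the unit ball, so their difference is its own fractional part and the
    inequality only concerns the first l_n digits. *)
Lemma approx_setP (g : lball F) (Q : {poly F}) : approx_set g Q <->
  exists n : nat, size Q = n.+1 /\
    orbit_digits f (l n) Q = digits (l n) (lball_val g).
Proof.
suff iff_n n : lnorm (lfrac (lpoly Q * (f : laurent F)) - lball_val g) < (#|F|%:R ^+ l n)^-1
    <-> orbit_digits f (l n) Q = digits (l n) (lball_val g).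
  by split=> -[n [sQ /iff_n]]; exists n.
set h := _ - _; have -> : h = lfrac h.
  apply: laurentP => i; rewrite /= {2}/lfrac_coef; case: leP => // i1.
  rewrite /lfrac_coef leNgt i1 /=.
  by have /in_lballP -> // := valP g; rewrite subrr.
rewrite lnorm_ltP -digits_eq0P /h raddfB /= digits_lfrac.
by rewrite -/(orbit_digits f (l n) Q); split=> [/eqP|->]; rewrite ?subrr // subr_eq0 => /eqP.
Qed.

(** * Divergence: almost every g is approximated infinitely often *)

Lemma ae_approx : (forall A : R, exists N, A <= \sum_(0 <= n < N) term n) ->
  {ae mu, forall g : lball_borel F, infinite_set (approx_set g)}.
Proof.
move=> unb.
pose B N0 : set (lball_borel F) := [set g : lball F | forall j (Q : {poly F}),
  (N0 <= j)%N -> size Q = j.+1 -> orbit_digits f (depth j) Q <> digits (depth j) (lball_val g)].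
suff nB N0 : mu.-negligible (B N0).
  (* If g has finitely many approximants, let N0 be the largest of their sizes. A hit at [depth j]
     is also one at l_j, so none occurs in degree j >= N0. *)
  apply: negligibleS (negligible_bigcup nB) => g /= /contrapT /finite_seqP[s sE].
  exists (\max_(Q <- s) size Q)%N => //= j Q sj sQ E.
  have : Q \in s.
    suff : [set` s] Q by [].
    rewrite -sE; apply/approx_setP; exists j; split=> //.
    by apply: digits_leq E; exact: leq_maxr.
  move=> Qs.
  have := @leq_bigmax_seq _ s xpredT (fun Q : {poly F} => size Q) Q Qs isT.
  by rewrite sQ ltnNge sj.
apply: negligible_small => n.
(* Chebyshev's bound 3 / e is at most 1 / (n+1) once e >= 3 (n+1); the terms of index below N0 are
   added because they are discarded later. *)
have [N AN] := unb (\sum_(0 <= i < N0) term i + 3 * n.+1%:R).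
have N0N : (N0 <= N)%N.
  rewrite leqNgt; apply/negP => /ltnW NN0; move: AN.
  rewrite (big_cat_nat (n := N) (p := N0)) //= -addrA gerDl leNgt.
  by rewrite ltr_wpDl ?mulr_gt0 ?sumr_ge0 // => i _; exact: term_ge0.
have tw : 3 * n.+1%:R <= total_weight R F depth N0 N.
  move: AN; rewrite (big_cat_nat (n := N0) (p := N)) //= lerD2l => /le_trans; apply.
  (* A weight is q - 1 >= 1 times the corresponding term. *)
  apply: ler_sum => i _; rewrite /weight /term -mulrA ler_peMl ?term_ge0 //.
  by rewrite lerBrDr -[1 + 1]/(2%:R) ler_nat card_finNzRing_gt1.
have tw0 : 0 < total_weight R F depth N0 N by apply: lt_le_trans tw; rewrite mulr_gt0.
have dM j : (j < N)%N -> (depth j <= depth N)%N by move=> jN; apply: depth_mono; exact: ltnW.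
exists (cylinder (fun w : 'rV[F]_(depth N) => total_hits R f depth N0 N w == 0)).
  exact: measurable_cylinder.
split.
  move=> g Bg; rewrite /cylinder /= /total_hits big_nat big1 // => j /andP[N0j jN].
  rewrite /hits big1 // => x x0; case: eqP => // E; case: (Bg j (poly_lead x) N0j).
    exact: size_poly_lead.
  by rewrite E; apply: digits_leq (dM _ jN) _; rewrite digits_fill.
rewrite [leLHS](measure_cylinder mu_haar) lee_fin ler_pdivrMr ?qX_gt0 //.
apply: le_trans (no_hit_bound (best_approximation f_irrational) c_lt blockP
  depth_mono depth_ge dM tw0) _.
rewrite mulrC ler_wpM2r ?qX_ge0 // ler_pdivrMr // mulrC ler_pdivlMr //.
Qed.

(** * Convergence: covers of small measure and Borel-Cantelli *)

Lemma measure_image s (I : finType) (phi : I -> 'rV[F]_s) :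
  (mu (cylinder (fun v => [exists i, phi i == v])) <= (#|I|%:R / q ^+ s)%:E)%E.
Proof.
rewrite (measure_cylinder mu_haar) lee_fin ler_wpM2r ?invr_ge0 ?qX_ge0 //.
apply: (@le_trans _ _ (\sum_(v : 'rV[F]_s) \sum_(i : I) (phi i == v)%:R)).
  apply: ler_sum => v _; case: existsP => [[i iv]|_] /=; last first.
    by apply: sumr_ge0 => i _; exact: ler0n.
  by rewrite (bigD1 i) //= iv lerDl; apply: sumr_ge0 => j _; exact: ler0n.
rewrite exchange_big /= (eq_bigr (fun=> 1)) ?sumr_const // => i _.
by rewrite (bigD1 (phi i)) //= eqxx big1 ?addr0 // => v; rewrite eq_sym => /negPf ->.
Qed.

(* With [t = c k.+1 - l n], write [Q = u + A * Q_k + v * X^t * Q_k] where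
   [size A <= t]: the middle term does not move the first [l n] digits. *)
Lemma orbit_digits_split n (Q : {poly F}) : size Q = n.+1 ->
  let k := block n in let t := (c k.+1 - l n)%N in
  exists (u : 'rV[F]_(c k)) (v : 'rV[F]_(n.+1 - c k - t)),
    orbit_digits f (l n) Q =
    orbit_digits f (l n) (rVpoly u + rVpoly v * ('X^t * convergent_den f k)).
Proof.
move=> sQ /=; set k := block n; set t := (c k.+1 - l n)%N; set dk := convergent_den f k.
have dk0 : dk != 0 by exact: den_neq0.
have sdk : size dk = (c k).+1 by exact: size_den.
have sd : size ('X^t * dk) = (t + c k).+1.
  by rewrite size_monicM ?monicXn // size_polyXn sdk addSn addnS.
have d0 : 'X^t * dk != 0 by rewrite -size_poly_gt0 sd.
set r := Q %% ('X^t * dk); set B := Q %/ ('X^t * dk).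
have sB : (size B <= n.+1 - c k - t)%N by rewrite size_divp // sd sQ /=; lia.
have sr : (size r <= t + c k)%N by rewrite -ltnS -sd ltn_modp.
have sA : (size (r %/ dk)%R <= t)%N by rewrite size_divp // sdk /= leq_subLR addnC.
have su : (size (r %% dk)%R <= c k)%N by rewrite -ltnS -sdk ltn_modp.
exists (poly_rV (r %% dk)), (poly_rV B).
rewrite !poly_rV_K // {1}(divp_eq Q ('X^t * dk)) -/B -/r {1}(divp_eq r dk).
rewrite addrCA raddfD /= [X in X + _](_ : _ = 0) ?add0r 1?addrC //.
exact: digits_mul_den sA.
Qed.

Definition near_orbit n : set (lball_borel F) := cylinder (fun v : 'rV[F]_(l n) =>
  [exists x : 'rV[F]_(c (block n)) * 'rV[F]_(n.+1 - c (block n) - (c (block n).+1 - l n)),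
    orbit_digits f (l n) (rVpoly x.1 + rVpoly x.2 *
      ('X^(c (block n).+1 - l n) * convergent_den f (block n))) == v]).

(** The depth is taken at the first degree n_k of the block, so that one set serves all its degrees;
    since l is nondecreasing, it contains the neighbourhoods at depth l_n. *)
Definition near_short k : set (lball_borel F) := cylinder (fun v : 'rV[F]_(l (c k)) =>
  [exists u : 'rV[F]_(c k), orbit_digits f (l (c k)) (rVpoly u) == v]).

(* [near_short k] is placed at the index [n] with [n + 1 = c k], so that the
   whole set at index [n] has measure at most [2 q] times [term n]. *)
Definition limit_cover n : set (lball_borel F) :=
  (if (c (block n).+1 - l n <= n - c (block n))%N then near_orbit n else set0) `|`
  (if n.+1 == c (block n).+1 then near_short (block n).+1 else set0).

Lemma measurable_limit_cover n : measurable (limit_cover n).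
Proof.
by apply: measurableU; case: ifP => // _; exact: measurable_cylinder.
Qed.

(** There are q^(n+1-t) pairs and radius q^-l_n, with t = n_(k+1) - l_n truncated at 0, so that t +
    l_n is exactly [depth n]. *)
Lemma measure_near_orbit n : (c (block n).+1 - l n <= n - c (block n))%N ->
  (mu (near_orbit n) <= (q * term n)%:E)%E.
Proof.
move=> tn; apply: le_trans (measure_image _) _; rewrite lee_fin.
have /andP[cn nc] := blockP n.
rewrite card_prod !card_mx !mul1n -expnD natrX /term mulrA -exprS.
rewrite ler_pdivrMr ?qX_gt0 // mulrAC ler_pdivlMr ?qX_gt0 // -!exprD.
by rewrite ler_eXn2l ?q_gt1 // /depth; lia.
Qed.

(** If l_(n+1) < n+1, then q times the term is 1 and the trivial bound suffices. Otherwise count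
    q^(n+1) balls of radius q^-l_(n+1), where l_(n+1) >= max(n+1, l_n). *)
Lemma measure_near_short n : n.+1 = c (block n).+1 ->
  (mu (near_short (block n).+1) <= (q * term n)%:E)%E.
Proof.
move=> nE; have ln : (l n <= l n.+1)%N by exact: l_mono.
have [cl|lc] := leqP n.+1 (l n.+1); last first.
  apply: le_trans (probability_le1 _ (measurable_cylinder _)) _.
  rewrite lee_fin /term mulrA -exprS ler_pdivlMr ?qX_gt0 // mul1r.
  by rewrite ler_eXn2l ?q_gt1 // /depth; lia.
apply: le_trans (measure_image _) _; rewrite lee_fin.
rewrite card_mx !mul1n natrX -nE /term mulrA -exprS ler_wpM2l ?qX_ge0 //.
by rewrite lef_pV2 ?posrE ?qX_gt0 // ler_eXn2l ?q_gt1 // /depth; lia.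
Qed.

Lemma measure_limit_cover n : (mu (limit_cover n) <= (2 * (q * term n))%:E)%E.
Proof.
have qt : (0 <= (q * term n)%:E)%E by rewrite lee_fin mulr_ge0 ?term_ge0.
apply: le_trans (measureU2 _ _ _) _.
- by case: ifP => // _; exact: measurable_cylinder.
- by case: ifP => // _; exact: measurable_cylinder.
rewrite mulrDl mul1r EFinD leeD //.
  by case: ifP => [|_]; [exact: measure_near_orbit | rewrite measure0].
by case: eqP => [|_]; [exact: measure_near_short | rewrite measure0].
Qed.

Lemma approx_sub_limit_cover (g : lball F) :
  infinite_set (approx_set g) -> lim_sup_set limit_cover g.
Proof.
move=> ginf n0 _.
(* Degree at least n_(n0+1) puts Q in a block k+1 > n0, so that both possible indices, n and n_(k+1)
   - 1, are at least n0. *)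
have [Q QS sQ] : exists2 Q, approx_set g Q & (c n0.+1 < size Q)%N.
  apply: contrapT => none; apply: ginf.
  apply: (@sub_finite_set _ _ (rVpoly @` [set: 'rV[F]_(c n0.+1)])).
    move=> Q QS; exists (poly_rV Q) => //; apply: poly_rV_K.
    by rewrite leqNgt; apply/negP => sQ; apply: none; exists Q.
  exact: finite_image finite_finset.
have /approx_setP[n [sQn E]] := QS.
have cn : (c n0.+1 <= n)%N by rewrite -ltnS -sQn.
have bn : (n0 < block n)%N.
  by rewrite -(blockE (k := n0.+1) (n := c n0.+1)) ?leqnn ?c_lt //; exact: block_mono.
have [u [v]] := orbit_digits_split sQn; rewrite E => gE.
have /andP[ckn nck] := blockP n.
have [tn|nt] := leqP (c (block n).+1 - l n)%N (n - c (block n))%N.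
  exists n; first by rewrite /= (leq_trans (c_ge n0)) // (leq_trans (ltnW (c_lt _))).
  by left; rewrite tn /near_orbit /cylinder /=; apply/existsP; exists (u, v); rewrite gE.
(* In this case [v] has length 0: only the part of degree below that of the denominator remains. *)
have v0 : rVpoly v = 0.
  by apply/eqP; rewrite -size_poly_leq0 (leq_trans (size_rVpoly v)) //; lia.
rewrite {}v0 mul0r addr0 in gE.
have [k kE] : exists k, block n = k.+1 by exists (block n).-1; rewrite prednK //; lia.
have ck := c_lt k.
have jE : ((c k.+1).-1).+1 = c k.+1 by rewrite prednK //; lia.
have bj : block (c k.+1).-1 = k by apply: blockE; lia.
exists (c k.+1).-1; first by have := c_ge k; rewrite /=; lia.
right; rewrite bj jE eqxx /near_short /cylinder /=; apply/existsP.
rewrite kE in u gE ckn *; exists u; apply/eqP/esym.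
by apply: digits_leq (l_mono ckn) _.
Qed.

Lemma approx_unbounded : {ae mu, forall g : lball_borel F, infinite_set (approx_set g)} ->
  forall A : R, exists N, A <= \sum_(0 <= n < N) term n.
Proof.
move=> aeg A; apply: contrapT => /forallNP lt.
have sum_fin : (\sum_(0 <= n <oo) mu (limit_cover n) < +oo)%E.
  apply: (@le_lt_trans _ _ (2 * (q * A))%:E); last exact: ltry.
  apply: lime_le; first by apply: is_cvg_nneseries => n _ _; exact: measure_ge0.
  near=> N; apply: (@le_trans _ _ (\sum_(0 <= n < N) (2 * (q * term n))%:E)%E).
    by apply: lee_sum => n _; exact: measure_limit_cover.
  rewrite sumEFin lee_fin -!mulr_sumr !ler_wpM2l ?(ltW (q_gt0 _ _)) //.
  by rewrite ltW // ltNge; apply/negP; exact: lt.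
have lim0 := lim_sup_set_cvg0 measurable_limit_cover sum_fin.
have mlim : measurable (lim_sup_set limit_cover).
  apply: bigcapT_measurable => n; apply: bigcup_measurable => j _.
  exact: measurable_limit_cover.
apply: (@negligible_setT _ _ mu).
(* The g with infinitely many approximants lie in the null limsup set, the others are negligible by
   assumption; together they would make the whole space negligible. *)
have /negligibleU /(_ aeg) : mu.-negligible (lim_sup_set limit_cover).
  by exists (lim_sup_set limit_cover); split.
apply: negligibleS => g _ /=.
have [gi|gi] := pselect (infinite_set (approx_set g)); last by right.
by left; exact: approx_sub_limit_cover.
Unshelve. all: by end_near. Qed.

End KhintchineGroshev.

Theorem theorem5p1 (R : realType) (F : finFieldType)
  (mu : probability (lball_borel F) R) (mu_haar : is_haar mu)
  (l : nat -> nat) (l_nondecreasing : {homo l : m n / (m <= n)%N})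
  (f : lball F) (f_irrational : lirrational f) :
  {ae mu, forall g : lball_borel F,
    infinite_set [set Q : {poly F} | exists n : nat, size Q = n.+1 /\
      lnorm (lfrac (lpoly Q * (f : laurent F)) - lball_val g)
        < (#|F|%:R ^+ l n)^-1]}
  <->
  (\sum_(0 <= k <oo)
     (\sum_(convergent_deg f k <= n < convergent_deg f k.+1)
        #|F|%:R ^ (n%:Z - (maxn (convergent_deg f k.+1) (l n))%:Z))%:E = +oo :> \bar R)%E.
Proof.
split=> [aeg|S].
  apply/(block_series_pinfty _ l f_irrational).
  exact: (approx_unbounded mu_haar l_nondecreasing f_irrational aeg).
apply: (ae_approx mu_haar l_nondecreasing (f_irrational := f_irrational)).
exact/block_series_pinfty.
Qed.
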